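(* Let $\mathbb K$ be a commutative ring, $B$ a finite set endowed with a linear order and an involution $b\mapsto b^*$, and $\mathscr A$ an infinite totally ordered set; order $\mathscr A\times B$ lexicographically. (1) The map $\Phi:\mathscr F(\mathbb KB)\to\mathbb K\langle\langle\mathscr A\times B\rangle\rangle$ is an injective morphism of algebras (for the external product $*$ on $\mathscr F(\mathbb KB)$). (2) If $I$ denotes the kernel of the canonical morphism $\mathbb K\langle\langle\mathscr A\times B\rangle\rangle\to\mathbb K[[\mathscr A\times B]]$ (which sends each word to its commutative monomial), then $\Phi^{-1}(I)=\mathscr D(B)^\circ$.
   Context: $\mathbb K\langle\langle\mathscr A\times B\rangle\rangle$ is the algebra of non-commutative formal power series in the letters of $\mathscr A\times B$ (possibly infinite linear combinations of words), $\mathbb K[[\mathscr A\times B]]$ its commutative analogue. $\mathfrak S_n$ is the symmetric group with unit $e_n$. $B\wr\mathfrak S_n=B^n\times\mathfrak S_n$, elements $(b_1,\dots,b_n;\sigma)$, $\pi\cdot(b_1,\dots,b_n;\sigma)=(b_{\pi^{-1}(1)},\dots,b_{\pi^{-1}(n)};\pi\sigma)$, is a basis of $\mathscr F_n(\mathbb KB)=(\mathbb KB)^{\otimes n}\otimes\mathbb K\mathfrak S_n$; $\mathscr F(\mathbb KB)=\bigoplus_{n\ge0}\mathscr F_n(\mathbb KB)$ with external product $(b_1,\dots,b_n;\sigma)*(b'_1,\dots,b'_{n'};\sigma')=x_{(n,n')}\cdot(b_1,\dots,b_n,b'_1,\dots,b'_{n'};\sigma\times\sigma')$, where $x_{(n,n')}$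 is the sum of the permutations of $\mathfrak S_{n+n'}$ increasing on $[1,n]$ and on $[n+1,n+n']$ and $\sigma\times\sigma'$ equals $\sigma$ on $[1,n]$ and $a\mapsto n+\sigma'(a-n)$ on $[n+1,n+n']$. The standardization of a word $x_1\cdots x_n$ over a totally ordered alphabet is the permutation obtained by replacing the letters by $1,\dots,n$, smallest letters first, equal letters from left to right. For a word $w=x_1\cdots x_n$ with $x_i=(a_i,b_i)\in\mathscr A\times B$ and standardization $\sigma$, its $B$-standardization is $\mathrm{std}_B(w)=\sigma\cdot(b_1,\dots,b_n;e_n)=(b_{\sigma^{-1}(1)},\dots,b_{\sigma^{-1}(n)};\sigma)$. $\Phi$ is the $\mathbb K$-linear map with $\Phi(\alpha)=\sum_{w:\ \mathrm{std}_B(w)=\alpha}w$ for $\alpha\in B\wr\mathfrak S_n$. $\mathscr D(B)$ is the subalgebra of $(\mathscr F(\mathbb KB),* )$ generated by the elements $(b,\dots,b;e_n)$, $n\ge1$, $b\in B$. For $\alpha=(b_1,\dots,b_n;\sigma)$, $\alpha^*=\sigma^{-1}\cdot(b_1^*,\dots,b_n^*;e_n)$; $\varpi_{\mathrm{tot}}$ is the bilinear form with $\varpi_{\mathrm{tot}}(\alpha,\beta)=1$ if $\beta=\alpha^*$ and $0$ otherwise on basis elements; $\mathscr D(B)^\circ=\{x\in\mathscr F(\mathbb KB)\mid\varpi_{\mathrm{tot}}(x,\mathscr D(B))=0\}$. *)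

(* Defs.v *)
From HB Require Import structures.
From mathcomp Require Import all_boot all_order all_fingroup all_algebra.
From mathcomp Require Import finmap multiset.
From mathcomp.multinomials Require Import monalg.
From mathcomp Require Import boolp classical_sets functions cardinality.

Set Implicit Arguments.
Unset Strict Implicit.
Unset Printing Implicit Defensive.

Import Order.TTheory GRing.Theory.

Local Open Scope classical_set_scope.
Local Open Scope ring_scope.

Section Shuffle.
Variables n n' : nat.

(* x_(n,n') is the sum of the permutations satisfying this predicate *)
Definition is_shuffle (p : 'S_(n + n')) : bool :=
  [forall i : 'I_n, forall j : 'I_n,
     (i < j)%N ==> (p (lshift n' i) < p (lshift n' j))%N] &&
  [forall i : 'I_n', forall j : 'I_n',
     (i < j)%N ==> (p (rshift n i) < p (rshift n j))%N].

Definition prod_perm_fun (s : 'S_n) (s' : 'S_n') (i : 'I_(n + n')) :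
    'I_(n + n') :=
  match fintype.split i with
  | inl j => lshift n' (s j)
  | inr j => rshift n (s' j)
  end.

Lemma prod_perm_inj s s' : injective (prod_perm_fun s s').
Proof.
move=> i j; rewrite /prod_perm_fun -[i]splitK -[j]splitK !unsplitK.
case: (fintype.split i) (fintype.split j) => [u|u] [v|v] //= /eqP.
- by rewrite eq_lshift => /eqP/perm_inj->.
- by rewrite eq_lrshift.
- by rewrite eq_rlshift.
- by rewrite eq_rshift => /eqP/perm_inj->.
Qed.

Definition prod_perm (s : 'S_n) (s' : 'S_n') : 'S_(n + n') :=
  perm (@prod_perm_inj s s').

End Shuffle.

Section Standardization.
Variables (d : Order.disp_t) (X : orderType d) (w : seq X).

(* Letters are compared first, and positions break the ties: the standardization
   sends a position to its rank among all positions. *)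
Definition pos_key (i : 'I_(size w)) : X *l 'I_(size w) :=
  (tnth (in_tuple w) i, i).

Definition smaller_pos (i : 'I_(size w)) : {set 'I_(size w)} :=
  [set j | (pos_key j < pos_key i)%O].

Lemma std_rank_subproof i : (#|smaller_pos i| < size w)%N.
Proof.
rewrite -[X in (_ < X)%N]card_ord -[X in (_ < X)%N]cardsT; apply/proper_card.
by rewrite properT; apply/eqP => /setP/(_ i); rewrite !inE ltxx.
Qed.

Definition std_rank (i : 'I_(size w)) : 'I_(size w) :=
  Ordinal (std_rank_subproof i).

Lemma std_rank_inj : injective std_rank.
Proof.
have lt_rank i j : (pos_key i < pos_key j)%O ->
    (#|smaller_pos i| < #|smaller_pos j|)%N.
  move=> ij; apply/proper_card/properP; split.
    by apply/fintype.subsetP => k; rewrite !inE => /lt_trans; apply.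
  by exists i; rewrite !inE ?ltxx.
move=> i j [eq_ij].
by case: (ltgtP (pos_key i) (pos_key j)) => [/lt_rank|/lt_rank|[]//];
  rewrite eq_ij ltnn.
Qed.

Definition std : 'S_(size w) := perm std_rank_inj.

End Standardization.

Section WreathProducts.
Variable B : choiceType.

Definition wr (n : nat) : Type := (n.-tuple B * 'S_n)%type.
HB.instance Definition _ n := Choice.copy (wr n) (n.-tuple B * 'S_n)%type.

(* disjoint union over n of the wreath products of B with 'S_n *)
Definition wreath : Type := {n : nat & wr n}.
HB.instance Definition _ := Choice.copy wreath {n : nat & wr n}.

Definition Wr n (a : wr n) : wreath := Tagged wr a.

(* 'S_n composes from left to right: (s * p) i = p (s i). Hence the product
   of p and s in the functional convention is s * p. *)
Definition wact n (p : 'S_n) (a : wr n) : wr n :=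
  ([tuple tnth a.1 ((p^-1)%g i) | i < n], (a.2 * p)%g).

Definition wcat n n' (a : wr n) (a' : wr n') : wr (n + n') :=
  (cat_tuple a.1 a'.1, prod_perm a.2 a'.2).

Definition wstar (star : B -> B) (a : wreath) : wreath :=
  Wr (wact ((tagged a).2^-1)%g (map_tuple star (tagged a).1, 1%g)).

End WreathProducts.

Section FreeModule.
Variables (K : comPzRingType) (B : choiceType).

(* The direct sum of the F_n(KB), as the free K-module on the wreath elements.
   The library makes {malg K[_]} a module only if K is a nonzero ring. *)
Definition FB : Type := {malg K[wreath B]}.
HB.instance Definition _ := GRing.Zmodule.copy FB {malg K[wreath B]}.

Definition FB_scale (c : K) (x : FB) : FB :=
  \sum_(a <- msupp x) << c * x@_a *g a >>.

Lemma FB_scaleE c x a : (FB_scale c x)@_a = c * x@_a.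
Proof.
rewrite {2}[x](@monalgE (wreath B) K x) !raddf_sum mulr_sumr.
by apply/eq_bigr => /= i _; rewrite !mcoeffU mulrnAr.
Qed.

Fact FB_scaleA c1 c2 x :
  FB_scale c1 (FB_scale c2 x) = FB_scale (c1 * c2) x.
Proof. by apply/malgP => a; rewrite !FB_scaleE mulrA. Qed.

Fact FB_scale1 : left_id 1 FB_scale.
Proof. by move=> x; apply/malgP => a; rewrite FB_scaleE mul1r. Qed.

Fact FB_scaleDr : right_distributive FB_scale +%R.
Proof.
by move=> c x y; apply/malgP => a; rewrite !(mcoeffD, FB_scaleE) mulrDr.
Qed.

Fact FB_scaleDl x : {morph FB_scale^~ x : c1 c2 / c1 + c2}.
Proof.
by move=> c1 c2; apply/malgP => a; rewrite !(mcoeffD, FB_scaleE) mulrDl.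
Qed.

HB.instance Definition _ := GRing.Zmodule_isLmodule.Build K FB
  FB_scaleA FB_scale1 FB_scaleDr FB_scaleDl.

Definition FBbasis (a : wreath B) : FB := << a >>.

Definition FB1 : FB := FBbasis (Wr ([tuple], 1%g)).

Definition ext_prod_basis (a a' : wreath B) : FB :=
  \sum_(p : 'S_(tag a + tag a') | is_shuffle p)
    FBbasis (Wr (wact p (wcat (tagged a) (tagged a')))).

Definition ext_prod (x y : FB) : FB :=
  \sum_(a <- msupp x) \sum_(a' <- msupp y)
    (x@_a * y@_a') *: ext_prod_basis a a'.

Definition is_subalgebra (S : set FB) : Prop :=
  [/\ S FB1,
      forall (c : K) (x y : FB), S x -> S y -> S (c *: x + y)
    & forall x y : FB, S x -> S y -> S (ext_prod x y)].

Definition D_generators : set FB :=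
  [set x | exists n : nat, exists b : B,
     (0 < n)%N /\ x = FBbasis (Wr (nseq_tuple n b, 1%g))].

Definition DB : set FB := smallest is_subalgebra D_generators.

Definition varpi_tot (star : B -> B) (x y : FB) : K :=
  \sum_(a <- msupp x) \sum_(b <- msupp y)
    x@_a * y@_b * (b == wstar star a)%:R.

Definition DB_orth (star : B -> B) : set FB :=
  [set x | forall y, DB y -> varpi_tot star x y = 0].

End FreeModule.

Arguments FB1 K B : clear implicits.
Arguments DB_orth K {B} star.

Section Series.
Variables (K : comPzRingType) (X : choiceType).

(* A non-commutative (resp. commutative) series is given by the coefficients
   of all words (resp. multisets). Only the module structure of the function
   space is inherited: its pointwise product is not that of series. *)
Definition ncseries : Type := seq X -> K.
HB.instance Definition _ := GRing.Lmodule.copy ncseries (seq X -> K^o).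

Definition ncseries1 : ncseries := fun w => (w == [::])%:R.

Definition ncseries_mul (f g : ncseries) : ncseries :=
  fun w => \sum_(i < (size w).+1) f (take i w) * g (drop i w).

Definition cseries : Type := {mset X}%mset -> K.
HB.instance Definition _ := GRing.Zmodule.copy cseries ({mset X}%mset -> K).

(* the words whose commutative monomial is m *)
Lemma mem_permutations_mset (m : {mset X}%mset) (w : seq X) :
  (w \in permutations m) = (seq_mset w == m).
Proof.
rewrite mem_permutations; apply/idP/eqP => [/eq_seq_msetP->|<-].
  exact: seq_mset_id.
by rewrite perm_sym perm_eq_seq_mset.
Qed.

Definition abelianize (f : ncseries) : cseries :=
  fun m => \sum_(w <- permutations m) f w.

Definition abelianize_ker : set ncseries := [set f | abelianize f = 0].

End Series.

Arguments ncseries1 K X : clear implicits.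
Arguments abelianize_ker K X : clear implicits.

Section Realization.
Variables (K : comPzRingType) (dA dB : Order.disp_t).
Variables (A : orderType dA) (B : finOrderType dB).

Definition stdB (w : seq (A *l B)) : wreath B :=
  Wr (wact (std w) (map_tuple snd (in_tuple w), 1%g)).

Definition Phi_basis (a : wreath B) : ncseries K (A *l B) :=
  fun w => (stdB w == a)%:R.

Definition Phi (x : FB K B) : ncseries K (A *l B) :=
  \sum_(a <- msupp x) x@_a *: Phi_basis a.

End Realization.

Arguments Phi K {dA dB} A B.

(* Main.v *)
Require Import Defs.
From mathcomp Require Import all_boot all_order all_fingroup all_algebra.
From mathcomp Require Import finmap multiset.
From mathcomp.multinomials Require Import monalg.
From mathcomp Require Import boolp classical_sets functions cardinality.

(* The coefficient of [Phi x] at a word [w] is the coefficient of [x] at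
   [stdB w].  Since [A] is infinite, every wreath element is the standardization
   of a word, whence injectivity; and a permutation of n + n' letters factors
   uniquely as a shuffle times a product s x s', whence multiplicativity.

   For the kernel, [DB] is spanned by products of generators
   (b_1,...,b_1;e) * ... * (b_k,...,b_k;e) with factors of sizes n_1, ..., n_k.
   Read through [Phi], the coefficient of such a product at [stdB v] is 1 if [v]
   splits into nondecreasing blocks of sizes n_i and colors b_i, else 0.
   On the other hand, let m be a multiset with letters x_1 < ... < x_k of
   multiplicities n_i.  The wreath elements [stdB w], for the rearrangements w
   of m, are pairwise distinct, and their images under [wstar] are exactly the
   [stdB v] with v splitting as above for b_i = (the color of x_i)^*.  So the
   coefficient of m in the abelianization of [Phi x] is the pairing of [x] with
   this product; conversely every product arises, by choosing the A-components
   increasing. *)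

Set Implicit Arguments.
Unset Strict Implicit.
Unset Printing Implicit Defensive.

Import Order.TTheory GRing.Theory.

Local Open Scope ring_scope.

(** * Permutations and wreath elements recovered from comparisons *)

Lemma perm_rank n (s : 'S_n) (i : 'I_n) :
  #|[set j | (s j < s i)%N]| = s i :> nat.
Proof.
have -> : [set j | (s j < s i)%N] = s @^-1: [set k : 'I_n | (k < s i)%N].
  by apply/setP => j; rewrite !inE.
rewrite card_preimset; last exact: perm_inj.
rewrite cardsE -sum1_card (big_ord_narrow (ltnW (ltn_ord (s i)))).
by rewrite sum1_card card_ord.
Qed.

(** By [perm_rank], each value is the number of positions with a smaller value, which the
    comparisons determine. *)
Lemma perm_ltn_inj n (s s' : 'S_n) :
  (forall i j, (s i < s j)%N = (s' i < s' j)%N) -> s = s'.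
Proof.
move=> ss'; apply/permP => i; apply: val_inj; rewrite /=.
rewrite -(perm_rank s) -(perm_rank s').
by apply: eq_card => j; rewrite !inE ss'.
Qed.

Lemma wr_eqP (C : choiceType) n (a a' : wr C n) :
  a.2 = a'.2 -> (forall i, tnth a.1 (a.2 i) = tnth a'.1 (a.2 i)) -> a = a'.
Proof.
case: a a' => [b s] [b' s'] /= ss' bb'; congr pair => //.
by apply: eq_from_tnth => i; rewrite -[i](permKV s).
Qed.

Lemma Wr_eq (C : choiceType) n (a a' : wr C n) : (Wr a == Wr a') = (a == a').
Proof. exact: eq_Tagged. Qed.

(** * B-standardization as a relation between tuples and wreath elements *)

Section Patterns.
Variables (dA dB : Order.disp_t) (A : orderType dA) (B : finOrderType dB).
Local Notation X := (A *l B)%type.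

Section Key.
Variables (n : nat) (t : n.-tuple X).

(** The order of [pos_key] on an n-tuple, so that positions live in ['I_n] and not in a type
    depending on the word. *)
Definition key_lt (i j : 'I_n) : bool :=
  (tnth t i <= tnth t j)%O && ((tnth t j <= tnth t i)%O ==> (i < j)%N).

Lemma key_lt_ltn (i j : 'I_n) :
  (i < j)%N -> key_lt i j = (tnth t i <= tnth t j)%O.
Proof. by rewrite /key_lt => ->; rewrite implybT andbT. Qed.

Lemma key_ltN i j : i != j -> key_lt i j = ~~ key_lt j i.
Proof.
rewrite -val_eqE neq_ltn => /orP[] ij; rewrite (key_lt_ltn ij) /key_lt.
  rewrite [(j < i)%N]ltnNge (ltnW ij) /= implybF.
  by case: (leP (tnth t i)) => [_|/ltW->]; rewrite ?andbF.
rewrite [(i < j)%N]ltnNge (ltnW ij) /= implybF.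
by case: (leP (tnth t j)) => [_|/ltW->]; rewrite ?andbF.
Qed.

(** Relational form of [stdB t = Wr a] (see [stdBP]), which avoids transporting permutations along
    equalities of sizes. *)
Definition pattern (a : wr B n) : Prop :=
  (forall i, (tnth t i).2 = tnth a.1 (a.2 i)) /\
  (forall i j, key_lt i j = (a.2 i < a.2 j)%N).

Lemma pattern_inj a a' : pattern a -> pattern a' -> a = a'.
Proof.
move=> [col ord] [col' ord'].
have eq2 : a.2 = a'.2 by apply: perm_ltn_inj => i j; rewrite -ord ord'.
by apply: wr_eqP => // i; rewrite -col eq2 col'.
Qed.

(** A tie between i < j puts i first, so the weak comparison of letters decides such pairs;
    [key_ltN] gives the reversed ones. *)
Lemma pattern_lt (a : wr B n) :
  (forall i, (tnth t i).2 = tnth a.1 (a.2 i)) ->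
  (forall i j : 'I_n, (i < j)%N ->
    (tnth t i <= tnth t j)%O = (a.2 i < a.2 j)%N) ->
  pattern a.
Proof.
move=> col ord; split=> // i j; have [ij|ji|/val_inj->] := ltngtP i j.
- by rewrite key_lt_ltn // ord.
- have neq : i != j by rewrite -val_eqE gtn_eqF.
  rewrite key_ltN // key_lt_ltn // ord // -leqNgt leq_eqVlt.
  by rewrite val_eqE (inj_eq perm_inj) (negbTE neq).
- by rewrite /key_lt !ltnn lexx.
Qed.

End Key.

(** Ranks strictly increase along the key order, by inclusion of the sets of smaller positions; the
    converse holds because that order is total. *)
Lemma std_lt (w : seq X) i j :
  key_lt (in_tuple w) i j = (std w i < std w j)%N.
Proof.
have keyE (k l : 'I_(size w)) :
    key_lt (in_tuple w) k l = (pos_key k < pos_key l)%O.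
  by rewrite ltEprodlexi.
have lt_rank (k l : 'I_(size w)) :
    (pos_key k < pos_key l)%O -> (std w k < std w l)%N.
  move=> kl; rewrite !permE /=; apply/proper_card/properP; split.
    by apply/fintype.subsetP => m; rewrite !inE => /lt_trans; apply.
  by exists k; rewrite !inE ?ltxx.
rewrite keyE; apply/idP/idP => [/lt_rank//|ij].
rewrite ltNge le_eqVlt negb_or; apply/andP; split.
  by apply/eqP => -[_ ji]; rewrite ji ltnn in ij.
by apply/negP => /lt_rank; rewrite ltnNge (ltnW ij).
Qed.

Lemma stdB_pattern n (t : n.-tuple X) :
  exists2 c : wr B n, stdB t = Wr c & pattern t c.
Proof.
case: t => w sz; have szE := eqP sz; subst n.
have -> : Tuple sz = in_tuple w by exact: val_inj.
exists (wact (std w) (map_tuple snd (in_tuple w), 1%g)) => //.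
split=> [i|i j] /=; last by rewrite mul1g std_lt.
by rewrite mul1g tnth_mktuple permK tnth_map.
Qed.

Lemma stdBP n (t : n.-tuple X) (a : wr B n) : (stdB t == Wr a) <-> pattern t a.
Proof.
have [c -> pc] := stdB_pattern t.
rewrite Wr_eq; split=> [/eqP<-//|pa]; apply/eqP; exact: pattern_inj pc pa.
Qed.

Lemma stdB_size n (w : seq X) (a : wr B n) : stdB w = Wr a -> size w = n.
Proof. by move/(congr1 tag). Qed.

Section Infinite.
Hypothesis infA : infinite_set [set: A].

Lemma increasing_seq n : exists2 s : seq A, size s = n & sorted <%O s.
Proof.
have [F _ szF] := infinite_set_fset n infA.
exists (take n (sort <=%O F)); first by rewrite size_takel // size_sort.
apply: take_sorted; rewrite lt_sorted_uniq_le sort_uniq fset_uniq.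
exact: sort_le_sorted.
Qed.

Lemma stdB_surj (a : wreath B) : exists w : seq X, stdB w = a.
Proof.
case: a => n [b s]; have [l szl sl] := increasing_seq n.
(* The A-components are distinct and ordered like the values of s, so they alone fix the
   standardization and leave the colors free. *)
pose t : n.-tuple X :=
  [tuple (tnth (tcast szl (in_tuple l)) (s i), tnth b (s i)) | i < n].
exists t; apply/eqP/stdBP/pattern_lt => [i|i j ij] /=; rewrite !tnth_mktuple //.
have lt_l (k m : 'I_n) : (k < m)%N ->
  (tnth (tcast szl (in_tuple l)) k < tnth (tcast szl (in_tuple l)) m)%O.
  have x0 : A := tnth (tcast szl (in_tuple l)) k.
  move=> km; rewrite !(tnth_nth x0) !val_tcast /=.
  by apply: (sorted_ltn_nth lt_trans) => //; rewrite inE szl.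
rewrite Order.ProdLexiOrder.leEprodlexi /=.
have [lt|lt|/val_inj/perm_inj eq] := ltngtP (s i) (s j).
- by rewrite (ltW (lt_l _ _ lt)) leNgt (lt_l _ _ lt).
- by rewrite leNgt (lt_l _ _ lt).
- by rewrite eq ltnn in ij.
Qed.

End Infinite.
End Patterns.

(** * Standardization of a concatenation and shuffles *)

Section ShuffleProduct.
Variables n n' : nat.

Lemma prod_perm_lshift (s : 'S_n) (s' : 'S_n') i :
  prod_perm s s' (lshift n' i) = lshift n' (s i).
Proof. by rewrite permE /prod_perm_fun (unsplitK (inl i)). Qed.

Lemma prod_perm_rshift (s : 'S_n) (s' : 'S_n') i :
  prod_perm s s' (rshift n i) = rshift n (s' i).
Proof. by rewrite permE /prod_perm_fun (unsplitK (inr i)). Qed.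

Lemma is_shuffleP (p : 'S_(n + n')) :
  reflect ((forall i j : 'I_n, (i < j)%N ->
              (p (lshift n' i) < p (lshift n' j))%N) /\
           (forall i j : 'I_n', (i < j)%N ->
              (p (rshift n i) < p (rshift n j))%N))
    (is_shuffle p).
Proof.
apply: (iffP andP) => -[hl hr]; split.
- by move=> i j ij; move/forallP/(_ i)/forallP/(_ j)/implyP: hl; apply.
- by move=> i j ij; move/forallP/(_ i)/forallP/(_ j)/implyP: hr; apply.
- by apply/forallP => i; apply/forallP => j; apply/implyP/hl.
- by apply/forallP => i; apply/forallP => j; apply/implyP/hr.
Qed.

Lemma ord_homo_mono k m (f : 'I_k -> 'I_m) :
  (forall i j : 'I_k, (i < j)%N -> (f i < f j)%N) ->
  forall i j : 'I_k, (f i < f j)%N = (i < j)%N.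
Proof.
move=> f_lt i j; have [/f_lt->//|/f_lt ji|/val_inj->] := ltngtP i j.
  by rewrite ltnNge ltnW.
by rewrite ltnn.
Qed.

Variables (dA dB : Order.disp_t) (A : orderType dA) (B : finOrderType dB).
Local Notation X := (A *l B)%type.
Variables (t : n.-tuple X) (t' : n'.-tuple X) (a : wr B n) (a' : wr B n').

Lemma key_lt_lshift i j :
  key_lt (cat_tuple t t') (lshift n' i) (lshift n' j) = key_lt t i j.
Proof. by rewrite /key_lt !tnth_lshift. Qed.

Lemma key_lt_rshift i j :
  key_lt (cat_tuple t t') (rshift n i) (rshift n j) = key_lt t' i j.
Proof. by rewrite /key_lt !tnth_rshift ltn_add2l. Qed.

(** Acting by p moves colors and ranks together, so the colors read along the word do not depend on
    p; only the order condition involves p. *)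
Lemma pattern_wact_cat (p : 'S_(n + n')) :
  pattern (cat_tuple t t') (wact p (wcat a a')) <->
  [/\ forall i, (tnth t i).2 = tnth a.1 (a.2 i),
      forall i, (tnth t' i).2 = tnth a'.1 (a'.2 i) &
      forall i j, key_lt (cat_tuple t t') i j =
        (p (prod_perm a.2 a'.2 i) < p (prod_perm a.2 a'.2 j))%N].
Proof.
split=> [[col ord]|[col col' ord]]; split.
- move=> i; have:= col (lshift n' i).
  by rewrite tnth_mktuple permM permK prod_perm_lshift !tnth_lshift.
- move=> i; have:= col (rshift n i).
  by rewrite tnth_mktuple permM permK prod_perm_rshift !tnth_rshift.
- by move=> i j; rewrite ord !permM.
- move=> i; rewrite tnth_mktuple permM permK.
  case: (split_ordP i) => k ->.
    by rewrite prod_perm_lshift !tnth_lshift.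
  by rewrite prod_perm_rshift !tnth_rshift.
- by move=> i j; rewrite ord !permM.
Qed.

Lemma pattern_cat_shuffle (p : 'S_(n + n')) :
  is_shuffle p -> pattern (cat_tuple t t') (wact p (wcat a a')) ->
  pattern t a /\ pattern t' a'.
Proof.
move=> /is_shuffleP[hl hr] /pattern_wact_cat[col col' ord].
split; split=> // i j.
- rewrite -key_lt_lshift ord !prod_perm_lshift.
  exact: (ord_homo_mono (f := fun i => p (lshift n' i))).
- rewrite -key_lt_rshift ord !prod_perm_rshift.
  exact: (ord_homo_mono (f := fun i => p (rshift n i))).
Qed.

Lemma pattern_cat_uniq (p q : 'S_(n + n')) :
  pattern (cat_tuple t t') (wact p (wcat a a')) ->
  pattern (cat_tuple t t') (wact q (wcat a a')) -> p = q.
Proof. by move=> pp pq; have [_ /mulgI] := pattern_inj pp pq. Qed.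

Lemma pattern_cat_ex :
  pattern t a -> pattern t' a' ->
  exists2 p, is_shuffle p & pattern (cat_tuple t t') (wact p (wcat a a')).
Proof.
move=> [col ord] [col' ord'].
have [c _ [_ ordc]] := stdB_pattern (cat_tuple t t').
(* The choice is forced: [prod_perm a.2 a'.2 * p] must be the standardization [c.2] of the
   concatenation. *)
exists ((prod_perm a.2 a'.2)^-1 * c.2)%g; last first.
  by apply/pattern_wact_cat; split=> // i j; rewrite !permM !permK ordc.
have inv_l i : (prod_perm a.2 a'.2)^-1%g (lshift n' i) = lshift n' (a.2^-1%g i).
  by apply: (canLR (permK _)); rewrite prod_perm_lshift permKV.
have inv_r i : (prod_perm a.2 a'.2)^-1%g (rshift n i) = rshift n (a'.2^-1%g i).
  by apply: (canLR (permK _)); rewrite prod_perm_rshift permKV.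
apply/is_shuffleP; split=> i j ij; rewrite !permM.
- by rewrite !inv_l -ordc key_lt_lshift ord !permKV.
- by rewrite !inv_r -ordc key_lt_rshift ord' !permKV.
Qed.

(** At most one permutation contributes, and a contributing shuffle exists exactly when both factors
    have the prescribed standardizations. *)
Lemma sum_shuffle_stdB (R : pzSemiRingType) :
  \sum_(p | is_shuffle p) (Wr (wact p (wcat a a')) == stdB (t ++ t'))%:R =
  (stdB t == Wr a)%:R * (stdB t' == Wr a')%:R :> R.
Proof.
have catP p : (Wr (wact p (wcat a a')) == stdB (t ++ t')) <->
    pattern (cat_tuple t t') (wact p (wcat a a')).
  by rewrite eq_sym; exact: (stdBP (cat_tuple t t')).
rewrite -natrM mulnb.
case: (boolP (_ && _)) => [/andP[/stdBP pa /stdBP pa']|nP].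
  have [p sp pp] := pattern_cat_ex pa pa'.
  rewrite (bigD1 p) //= (introT idP ((catP p).2 pp)).
  rewrite big1 ?addr0 // => q /andP[_ qp].
  case: (boolP (_ == _)) => // /catP pq.
  by rewrite (pattern_cat_uniq pq pp) eqxx in qp.
rewrite big1 // => p sp.
case: (boolP (_ == _)) => // /catP /(pattern_cat_shuffle sp)[].
by move=> /stdBP pa /stdBP pa'; rewrite pa pa' in nP.
Qed.

End ShuffleProduct.

(** * The algebra morphism property and injectivity of [Phi] *)

Section PhiMorphism.
Variables (K : comPzRingType) (dA dB : Order.disp_t).
Variables (A : orderType dA) (B : finOrderType dB).
Local Notation X := (A *l B)%type.

Lemma FB_coefE (C : choiceType) (x : FB K C) c :
  x@_c = \sum_(a <- msupp x) x@_a * (c == a)%:R.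
Proof.
rewrite [LHS](congr1 (mcoeff c) (@monalgE _ K x)) raddf_sum.
by apply: eq_bigr => a _; rewrite /= mcoeffU eq_sym mulr_natr.
Qed.

Lemma FB_coef_sum (C : choiceType) (I : Type) (r : seq I) (P : pred I)
  (F : I -> FB K C) a :
  (\sum_(i <- r | P i) F i)@_a = \sum_(i <- r | P i) (F i)@_a.
Proof. exact: raddf_sum. Qed.

Lemma FB_coefZ (C : choiceType) (c : K) (x : FB K C) a :
  (c *: x)@_a = c * x@_a.
Proof. exact: FB_scaleE. Qed.

(** Reduces claims about [Phi] to coefficients at standardizations of words. *)
Lemma PhiE (x : FB K B) (w : seq X) : Phi K A B x w = x@_(stdB w).
Proof.
rewrite FB_coefE /Phi.
exact: (big_morph (fun f : ncseries K X => f w) (id1 := 0) (op1 := +%R)).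
Qed.

Lemma ext_prod_basis_stdB (a a' : wreath B) (w : seq X) :
  (ext_prod_basis K a a')@_(stdB w) =
  \sum_(i < (size w).+1)
    (stdB (take i w) == a)%:R * (stdB (drop i w) == a')%:R.
Proof.
case: a a' => [n a] [n' a'].
rewrite /ext_prod_basis FB_coef_sum.
under eq_bigr => p _ do rewrite /FBbasis mcoeffU.
have [szw|szw] := eqVneq (size w) (n + n')%N; last first.
  rewrite big1 => [|p _]; last first.
    by case: eqP => // e; rewrite (stdB_size (esym e)) eqxx in szw.
  rewrite big1 // => i _; rewrite -natrM mulnb.
  case: eqP => //= /stdB_size sz; case: eqP => //= /stdB_size sz'.
  by rewrite -sz -sz' -size_cat cat_take_drop eqxx in szw.
have ltn : (n < (size w).+1)%N by rewrite szw ltnS leq_addr.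
have szt : size (take n w) == n by rewrite size_takel // szw leq_addr.
have szd : size (drop n w) == n' by rewrite size_drop szw addKn.
(* Only the cut after n letters gives a prefix of the right size. *)
rewrite (bigD1 (Ordinal ltn)) //= [X in _ + X]big1 ?addr0 => [|i]; last first.
  rewrite -val_eqE /= => ni; case: eqP => [/stdB_size|]; rewrite ?mul0r //.
  by rewrite size_takel -1?ltnS // => e; rewrite e eqxx in ni.
rewrite -(sum_shuffle_stdB (Tuple szt) (Tuple szd)) /= cat_take_drop.
by apply: eq_bigr.
Qed.

Lemma ext_prod_stdB (x y : FB K B) (w : seq X) :
  (ext_prod x y)@_(stdB w) =
  \sum_(i < (size w).+1) x@_(stdB (take i w)) * y@_(stdB (drop i w)).
Proof.
rewrite /ext_prod FB_coef_sum.
under eq_bigr => a _.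
  rewrite FB_coef_sum.
  under eq_bigr => a' _.
    rewrite FB_coefZ ext_prod_basis_stdB mulr_sumr; over.
  rewrite exchange_big; over.
rewrite exchange_big; apply: eq_bigr => i _ /=.
rewrite (FB_coefE x) (FB_coefE y).
rewrite mulr_suml; apply: eq_bigr => a _; rewrite mulr_sumr.
by apply: eq_bigr => a' _; rewrite mulrACA.
Qed.

Lemma Phi_linear : linear (Phi K A B).
Proof.
by move=> c x y; apply/funext => w; rewrite !PhiE mcoeffD FB_coefZ /= -!PhiE.
Qed.

Lemma Phi1 : Phi K A B (FB1 K B) = ncseries1 K X.
Proof.
apply/funext => w; rewrite PhiE /FB1 /FBbasis mcoeffU /ncseries1; congr _%:R.
congr nat_of_bool; apply/eqP/eqP => [/(congr1 tag)/esym/size0nil//|->].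
apply/eqP; rewrite eq_sym; apply/(stdBP (nil_tuple _)).
by split; case.
Qed.

Lemma Phi_ext_prod (x y : FB K B) :
  Phi K A B (ext_prod x y) = ncseries_mul (Phi K A B x) (Phi K A B y).
Proof.
apply/funext => w; rewrite PhiE ext_prod_stdB.
by apply: eq_bigr => i _; rewrite !PhiE.
Qed.

Lemma Phi_inj : infinite_set [set: A]%classic -> injective (Phi K A B).
Proof.
move=> infA x y xy; apply/malgP => a; have [w <-] := stdB_surj infA a.
by rewrite -!PhiE xy.
Qed.

End PhiMorphism.

(** * Products of generators, and their span *)

Section Blocks.
Variables (K : comPzRingType) (dA dB : Order.disp_t).
Variables (A : orderType dA) (B : finOrderType dB).
Local Notation X := (A *l B)%type.
Implicit Types (L : seq (B * nat)) (v : seq X).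

Definition block (b : B) n : FB K B := FBbasis K (Wr (nseq_tuple n b, 1%g)).

Definition block_prod L : FB K B :=
  foldr (fun q y => ext_prod (block q.1 q.2) y) (FB1 K B) L.

Definition block_word b v : bool :=
  all (fun x : X => x.2 == b) v && sorted <=%O v.

Fixpoint block_match L v : bool :=
  if L is (b, n) :: L' then
    [&& (n <= size v)%N, block_word b (take n v) & block_match L' (drop n v)]
  else v == [::].

(** Equal letters are ranked from left to right, so a word standardizes to the identity exactly when
    it is nondecreasing. *)
Lemma stdB_nseq b n v :
  (stdB v == Wr (nseq_tuple n b, 1%g)) = (size v == n) && block_word b v.
Proof.
case: (eqVneq (size v) n) => [sz|szn] /=; last first.
  by apply/negbTE/eqP => /stdB_size e; rewrite e eqxx in szn.
have sz' := introT eqP sz; pose t : n.-tuple X := Tuple sz'.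
rewrite /block_word (sorted_pairwise le_trans).
apply/idP/andP => [/(stdBP t)[col ord]|[/allP col /pairwiseP ord]].
- split.
    apply/(all_tnthP (t := t)) => i.
    by rewrite col /= (tnth_nth b) nth_nseq ltn_ord.
  case: v sz sz' @t col ord => // x0 v' sz sz' t col ord.
  apply/(pairwiseP x0) => i j; rewrite !inE sz => lti ltj ij.
  have := ord (Ordinal lti) (Ordinal ltj).
  by rewrite !perm1 /= ij /key_lt !(tnth_nth x0) /= => /andP[].
- apply/(stdBP t)/pattern_lt => [i|i j ij] /=.
    rewrite perm1 [RHS](tnth_nth b) nth_nseq ltn_ord; apply/eqP/col.
    exact: (mem_tnth i t).
  have x0 : X := tnth t i.
  rewrite !perm1 ij !(tnth_nth x0); apply: ord => //; rewrite inE sz;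
    exact: ltn_ord.
Qed.

Lemma block_match1 b n v :
  block_match [:: (b, n)] v = (size v == n) && block_word b v.
Proof.
rewrite /= -size_eq0 size_drop subn_eq0 eqn_leq.
by case: (leqP (size v) n) => [/take_oversize->|_]; rewrite ?andbF ?andbT.
Qed.

(** Multiplication by a block becomes deconcatenation on words, and only the cut at the size of that
    block survives. *)
Lemma block_prod_stdB L v :
  (block_prod L)@_(stdB v) = (block_match L v)%:R.
Proof.
elim: L v => [|[b n] L IH] v.
  by rewrite /= -PhiE Phi1.
rewrite [LHS]ext_prod_stdB [RHS]/=.
under eq_bigr => i _.
  rewrite /block /FBbasis mcoeffU eq_sym stdB_nseq /= IH -natrM mulnb; over.
have [ltn|gtn] /= := leqP n (size v); last first.
  rewrite big1 // => i _; rewrite size_takel -1?ltnS //.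
  by case: eqP => // e; rewrite ltnNge -e -ltnS ltn_ord in gtn.
rewrite (bigD1 (Ordinal (ltn : n < (size v).+1)%N)) //= big1 ?addr0.
  by rewrite size_takel // eqxx.
move=> i; rewrite -val_eqE /= => ni.
by rewrite size_takel -1?ltnS // (negbTE ni).
Qed.

Definition block_size L := sumn [seq q.2 | q <- L].

Lemma block_match_size L v : block_match L v -> size v = block_size L.
Proof.
elim: L v => [|[b n] L IH] v /=; first by move/eqP->.
move=> /and3P[le _ /IH]; rewrite size_drop /block_size /= => <-.
by rewrite subnKC.
Qed.

Lemma block_match_cat L L' v :
  block_match (L ++ L') v =
  [&& (block_size L <= size v)%N, block_match L (take (block_size L) v) &
      block_match L' (drop (block_size L) v)].
Proof.
elim: L v => [|[b n] L IH] v; first by rewrite /block_size /= take0 drop0.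
rewrite /= IH /block_size /= -/(block_size L) size_drop !size_take_min.
have [le|gt] := leqP n (size v); last first.
  by rewrite [(_ + _ <= _)%N]leqNgt (leq_trans gt (leq_addr _ _)).
rewrite leq_subRL //; case: leqP => //= le'; last by rewrite andbF.
rewrite leq_addr take_takel ?leq_addr // take_drop drop_drop [(n + _)%N]addnC.
by rewrite -!andbA.
Qed.

Hypothesis infA : infinite_set [set: A]%classic.

(** Transfers identities in [FB] to words; it stands in for separate proofs of associativity, unit
    law and bilinearity of [ext_prod]. *)
Lemma FB_stdB_ext (x y : FB K B) :
  (forall w : seq X, x@_(stdB w) = y@_(stdB w)) -> x = y.
Proof. by move=> xy; apply/(Phi_inj infA)/funext => w; rewrite !PhiE. Qed.

Lemma block_prod_cat L L' :
  ext_prod (block_prod L) (block_prod L') = block_prod (L ++ L').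
Proof.
apply: FB_stdB_ext => w; rewrite ext_prod_stdB block_prod_stdB block_match_cat.
under eq_bigr => i _ do rewrite !block_prod_stdB -natrM mulnb.
have [le|gt] /= := leqP (block_size L) (size w); last first.
  rewrite big1 // => i _.
  case: (boolP (block_match L _)) => // /block_match_size.
  rewrite size_takel -1?ltnS // => e.
  by rewrite ltnNge -e -ltnS ltn_ord in gt.
rewrite (bigD1 (Ordinal (le : block_size L < (size w).+1)%N)) //=.
rewrite big1 ?addr0 //.
move=> i; rewrite -val_eqE /= => ni.
case: (boolP (block_match L _)) => // /block_match_size.
by rewrite size_takel -1?ltnS // => e; rewrite e eqxx in ni.
Qed.

Lemma block_prod1 b n : block_prod [:: (b, n)] = block b n.
Proof.
apply: FB_stdB_ext => w; rewrite block_prod_stdB block_match1 -stdB_nseq.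
by rewrite /block /FBbasis mcoeffU eq_sym.
Qed.

Lemma DB_block_prod L : all (fun q => 0 < q.2)%N L -> DB (block_prod L).
Proof.
elim: L => [_|[b n] L IH /= /andP[n0 /IH DL]] M MH;
  have [[M1 _ MM] gM] := MH => //=.
apply: MM; first by apply: gM; exists n, b.
exact: DL.
Qed.

Lemma DB_span (y : FB K B) : DB y ->
  exists s : seq (K * seq (B * nat)), y = \sum_(q <- s) q.1 *: block_prod q.2.
Proof.
pose S : set (FB K B) := [set z | exists s : seq (K * seq (B * nat)),
  z = \sum_(q <- s) q.1 *: block_prod q.2]%classic.
(* As [DB] is a smallest set, it suffices that [S] is a subalgebra containing the generators;
   products are handled by concatenating lists of blocks. *)
apply: (_ : DB y -> S y); apply; split=> [|z [n [b [_ ->]]]]; last first.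
  by exists [:: (1, [:: (b, n)])]; rewrite big_seq1 scale1r block_prod1.
split=> [|c z z' [s ->] [s' ->]|z z' [s ->] [s' ->]].
- by exists [:: (1, [::])]; rewrite big_seq1 scale1r.
- exists ([seq (c * q.1, q.2) | q <- s] ++ s').
  rewrite big_cat big_map; congr (_ + _); rewrite scaler_sumr.
  by apply: eq_bigr => q _; rewrite scalerA.
- exists [seq (q.1 * q'.1, q.2 ++ q'.2) | q <- s, q' <- s'].
  apply: FB_stdB_ext => w; rewrite ext_prod_stdB big_allpairs_dep FB_coef_sum.
  under eq_bigr => i _ do rewrite !FB_coef_sum mulr_suml /=.
  rewrite exchange_big; apply: eq_bigr => q _ /=.
  under eq_bigr => i _ do rewrite mulr_sumr.
  rewrite exchange_big FB_coef_sum; apply: eq_bigr => q' _ /=.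
  rewrite FB_coefZ -block_prod_cat ext_prod_stdB mulr_sumr.
  by apply: eq_bigr => i _; rewrite !FB_coefZ mulrACA.
Qed.

End Blocks.

(** * Rearrangements of a sorted word and the involution [wstar] *)

Section WordMatch.
Variables (dA dB : Order.disp_t) (A : orderType dA) (B : finOrderType dB).
Local Notation X := (A *l B)%type.
Variable star : B -> B.

Definition color_match (q : X * X) : bool := q.2.2 == star q.1.2.

Definition order_match (q q' : X * X) : bool :=
  (q.1 == q'.1) ==> (q.2 <= q'.2)%O.

(** A positionwise form of [block_match]: for sorted s, the runs of equal letters of s delimit the
    blocks of v. *)
Definition word_match (s v : seq X) : bool :=
  [&& size s == size v, all color_match (zip s v) &
      pairwise order_match (zip s v)].

Lemma word_match_tupleP n (s v : n.-tuple X) :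
  word_match s v <->
  (forall i, (tnth v i).2 = star (tnth s i).2) /\
  (forall i j : 'I_n, (i < j)%N -> tnth s i = tnth s j ->
     (tnth v i <= tnth v j)%O).
Proof.
have tz i : tnth (zip_tuple s v) i = (tnth s i, tnth v i).
  have x0 := tnth s i; rewrite (tnth_nth (x0, x0)) !(tnth_nth x0) /=.
  by rewrite nth_zip // !size_tuple.
rewrite /word_match !size_tuple eqxx /=; split.
- move=> /andP[/(all_tnthP (t := zip_tuple s v)) col /pairwiseP ord].
  split=> [i|i j ij sij]; first by have := col i; rewrite tz => /eqP.
  have z0 := tnth (zip_tuple s v) i.
  have := ord z0 i j; rewrite !inE !(size_tuple (zip_tuple s v)) => /(_ _ _ ij).
  rewrite -!(tnth_nth z0 (zip_tuple s v)) !tz /order_match /= sij eqxx.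
  by apply; exact: ltn_ord.
- move=> [col ord]; apply/andP; split.
    apply/(all_tnthP (t := zip_tuple s v)) => i.
    by rewrite tz /color_match /= col.
  case sz : (zip s v) => [|z0 r] //; rewrite -sz; apply/(pairwiseP z0) => i j.
  rewrite !inE !(size_tuple (zip_tuple s v)) => lti ltj ij.
  rewrite -[i]/(val (Ordinal lti)) -[j]/(val (Ordinal ltj)).
  rewrite -!(tnth_nth z0 (zip_tuple s v)) !tz /order_match /=.
  by apply/implyP => /eqP/ord; apply.
Qed.

Lemma zip_nseq_map n (x : X) (u : seq X) : size u = n ->
  zip (nseq n x) u = [seq (x, y) | y <- u].
Proof. by move<-; elim: u => //= y u ->. Qed.

Lemma mem_zip1 (s v : seq X) q : q \in zip s v -> q.1 \in s.
Proof.
elim: s v => [|x s IH] [|y v] //; rewrite /= !inE => /orP[/eqP->|/IH->].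
  by rewrite eqxx.
by rewrite orbT.
Qed.

(** Since x does not recur in s, no order condition links the first run to the rest. *)
Lemma word_match_nseq n (x : X) (s v : seq X) : x \notin s ->
  word_match (nseq n x ++ s) v =
  [&& (n <= size v)%N, block_word (star x.2) (take n v) &
      word_match s (drop n v)].
Proof.
move=> xs; rewrite /word_match size_cat size_nseq size_drop.
have [le|gt] /= := leqP n (size v); last first.
  by rewrite gtn_eqF // (leq_trans gt) // leq_addr.
rewrite -(eqn_add2l n (size s)) subnKC //.
have szt := size_takel le.
have -> : zip (nseq n x ++ s) v =
    [seq (x, y) | y <- take n v] ++ zip s (drop n v).
  by rewrite -(zip_nseq_map x szt) -zip_cat ?size_nseq ?szt // cat_take_drop.
rewrite all_cat pairwise_cat all_map pairwise_map.
have -> : allrel order_match [seq (x, y) | y <- take n v] (zip s (drop n v)).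
  apply/allrelP => _ q /mapP[y _ ->] qz; rewrite /order_match /=.
  case: eqP => // xq; rewrite xq in xs; case/negP: xs.
  exact: mem_zip1 qz.
rewrite /block_word (sorted_pairwise le_trans) /=.
have -> : pairwise (relpre (pair x) order_match) (take n v) =
    pairwise <=%O (take n v).
  by apply: eq_pairwise => y y'; rewrite /order_match /= eqxx.
case: (_ == size v) => /=; last by rewrite !andbF.
by rewrite -!andbA; congr (_ && _); rewrite andbCA.
Qed.

Definition letters_word (L : seq (X * nat)) : seq X :=
  flatten [seq nseq q.2 q.1 | q <- L].

Definition star_blocks (L : seq (X * nat)) : seq (B * nat) :=
  [seq (star q.1.2, q.2) | q <- L].

Lemma mem_letters_word L x : x \in letters_word L -> x \in unzip1 L.
Proof.
move=> /flattenP[_ /mapP[q qL ->]]; rewrite mem_nseq => /andP[_ /eqP->].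
exact: map_f.
Qed.

Lemma word_match_letters L v : pairwise <%O (unzip1 L) ->
  word_match (letters_word L) v = block_match (star_blocks L) v.
Proof.
elim: L v => [|[x n] L IH] v /=.
  by rewrite /word_match /= eq_sym size_eq0; case: v.
move=> /andP[/allP xL /IH IHL]; rewrite word_match_nseq /= ?IHL //.
by apply/negP => /mem_letters_word /xL; rewrite ltxx.
Qed.

Lemma letters_word_sorted L : pairwise <%O (unzip1 L) ->
  sorted <=%O (letters_word L).
Proof.
rewrite (sorted_pairwise le_trans).
elim: L => [|[x n] L IH] //= /andP[/allP xL /IH pL].
rewrite pairwise_cat pL andbT; apply/andP; split.
  apply/allrelP => y z; rewrite mem_nseq => /andP[_ /eqP->].
  by move=> /mem_letters_word /xL /ltW.
by elim: n => //= n ->; rewrite andbT; apply/allP => y /nseqP[->].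
Qed.

(** Listing the letters of w by rank gives a sorted rearrangement of s, hence s itself. *)
Lemma perm_pattern n (s w : n.-tuple X) (a : wr B n) :
  sorted <=%O s -> perm_eq w s -> pattern w a ->
  forall i, tnth w i = tnth s (a.2 i).
Proof.
move=> ss ws [_ ord].
pose u := [tuple tnth w (a.2^-1%g k) | k < n].
have us : perm_eq u s.
  by apply: perm_trans ws; apply/tuple_permP; exists a.2^-1%g.
suff /val_inj us' : val u = val s by move=> i; rewrite -us' tnth_mktuple permK.
apply: (sorted_eq le_trans le_anti) us => //.
rewrite (sorted_pairwise le_trans).
case e : (val u) => [|x0 r] //; rewrite -e; apply/(pairwiseP x0) => i j.
rewrite !inE !size_tuple => lti ltj ij.
rewrite -[i]/(val (Ordinal lti)) -[j]/(val (Ordinal ltj)) -!(tnth_nth x0 u).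
rewrite !tnth_mktuple.
have := ord (a.2^-1%g (Ordinal lti)) (a.2^-1%g (Ordinal ltj)).
by rewrite !permKV /= ij /key_lt => /andP[].
Qed.

Hypothesis starI : involutive star.

(** The inverse permutation in [wstar] is undone when colors are read along v, so the starred colors
    of a appear in their original places. *)
Lemma wstar_pattern n (v : n.-tuple X) (a : wr B n) :
  (stdB v == wstar star (Wr a)) <->
  (forall i, (tnth v i).2 = star (tnth a.1 i)) /\
  (forall i j, key_lt v i j = (a.2^-1%g i < a.2^-1%g j)%N).
Proof.
have -> : wstar star (Wr a) =
  Wr (wact (a.2^-1)%g (map_tuple star a.1, 1%g)) by [].
split=> [/stdBP[col ord]|[col ord]].
  split=> [i|i j]; last by rewrite ord /= mul1g.
  by rewrite col tnth_mktuple /= mul1g permK tnth_map.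
apply/stdBP; split=> [i|i j]; last by rewrite ord /= mul1g.
by rewrite col tnth_mktuple /= mul1g permK tnth_map.
Qed.

(** The sum has at most one nonzero term. Whether it occurs depends on the colors and on the ties of
    s, and [word_match] tests these through v, whose standardization is the inverse of [a.2]. *)
Lemma sum_permutations_stdB (R : pzSemiRingType) n (s v : n.-tuple X)
    (a : wr B n) :
  sorted <=%O s -> stdB v = wstar star (Wr a) ->
  \sum_(w <- permutations s) (stdB w == Wr a)%:R = (word_match s v)%:R :> R.
Proof.
move=> ss /eqP/wstar_pattern[colv ordv].
(* [w0] is the only rearrangement of [s] that can standardize to [a]. *)
pose w0 := [tuple tnth s (a.2 i) | i < n].
have w0s : perm_eq w0 s by apply/tuple_permP; exists a.2.
have uniq0 w : w \in permutations s -> stdB w == Wr a ->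
    w = w0 /\ pattern w0 a.
  rewrite mem_permutations => ws wa.
  have szw : size w == n by rewrite (perm_size ws) size_tuple.
  have /(stdBP (Tuple szw)) pa := wa.
  suff e : Tuple szw = w0 by rewrite -e; split=> //; rewrite -e.
  apply: eq_from_tnth => i; rewrite tnth_mktuple.
  exact: (@perm_pattern _ _ (Tuple szw) _ ss ws pa).
have matchP : word_match s v <-> pattern w0 a.
  rewrite word_match_tupleP; split=> [[col ord]|[col ord]].
    apply: pattern_lt => [i|i j ij].
      by rewrite tnth_mktuple -[LHS]starI -col colv starI.
    rewrite !tnth_mktuple.
    have s_le (k l : 'I_n) : (k < l)%N -> (tnth s k <= tnth s l)%O.
      move=> kl; have x0 := tnth s k; rewrite !(tnth_nth x0).
      by apply: (sorted_leq_nth le_trans le_refl) => //;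
        rewrite ?inE ?size_tuple ?ltn_ord // ltnW.
    have [lt|lt|/val_inj/perm_inj eq] := ltngtP (a.2 i) (a.2 j).
    - exact: s_le.
    (* Sortedness turns [le] into an equality of letters of s; the matching then orders v at [a.2 j]
       and [a.2 i], which by [ordv] means j < i, against i < j. *)
    - apply/negbTE/negP => le.
      have e : tnth s (a.2 j) = tnth s (a.2 i) by apply: le_anti; rewrite s_le.
      have := ord _ _ lt e.
      by rewrite -key_lt_ltn // ordv !permK ltnNge (ltnW ij).
    - by rewrite eq ltnn in ij.
  split=> [i|i j ij sij].
    rewrite colv; congr star.
    by have := col (a.2^-1%g i); rewrite tnth_mktuple permKV.
  (* Equal letters of s at ranks i < j sit in [w0] at positions [a.2^-1 i] and [a.2^-1 j];
     left-to-right ranking of ties puts these positions in order. *)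
  rewrite -key_lt_ltn // ordv.
  have := ord (a.2^-1%g i) (a.2^-1%g j).
  by rewrite !permKV ij /key_lt !tnth_mktuple !permKV sij lexx.
case: (boolP (word_match s v)) => [/matchP pa|nm]; last first.
  rewrite big1_seq // => w /andP[_ ws]; case: (boolP (stdB w == _)) => // wa.
  by have [_ /matchP] := uniq0 w ws wa; rewrite (negbTE nm).
have w0p : val w0 \in permutations s by rewrite mem_permutations.
rewrite (bigD1_seq _ w0p) ?permutations_uniq //=.
rewrite (introT idP ((stdBP w0 a).2 pa)) big1_seq ?addr0 // => w /andP[ww0 ws].
case: (boolP (stdB w == _)) => // wa.
by have [e _] := uniq0 w ws wa; rewrite e eqxx in ww0.
Qed.

End WordMatch.

(** * Coefficients of the abelianization as pairings with [DB] *)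

Section Pairing.
Variables (K : comPzRingType) (dA dB : Order.disp_t).
Variables (A : orderType dA) (B : finOrderType dB) (star : B -> B).
Local Notation X := (A *l B)%type.

Lemma varpi_totE (x y : FB K B) :
  varpi_tot star x y = \sum_(a <- msupp x) x@_a * y@_(wstar star a).
Proof.
apply: eq_bigr => a _; under eq_bigr => b _ do rewrite -mulrA.
rewrite -mulr_sumr (FB_coefE y); congr (_ * _).
by apply: eq_bigr => b _; rewrite eq_sym.
Qed.

Lemma varpi_tot_sum (x : FB K B) (I : Type) (r : seq I) (c : I -> K)
    (F : I -> FB K B) :
  varpi_tot star x (\sum_(i <- r) c i *: F i) =
  \sum_(i <- r) c i * varpi_tot star x (F i).
Proof.
under [RHS]eq_bigr => i _ do rewrite varpi_totE mulr_sumr.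
rewrite exchange_big varpi_totE; apply: eq_bigr => a _ /=.
rewrite FB_coef_sum mulr_sumr; apply: eq_bigr => i _.
by rewrite FB_coefZ mulrCA.
Qed.

Hypothesis infA : infinite_set [set: A]%classic.
Hypothesis starI : involutive star.

(** Compared term by term over the support of x: the left side counts rearrangements standardizing
    to a basis element, the right side tests whether its star splits into the blocks. *)
Lemma abelianize_Phi (x : FB K B) (L : seq (X * nat)) :
  pairwise <%O (unzip1 L) ->
  abelianize (Phi K A B x) (seq_mset (letters_word L)) =
  varpi_tot star x (block_prod K (star_blocks star L)).
Proof.
move=> pL; rewrite /abelianize.
rewrite (perm_big _ (perm_permutations (perm_eq_seq_mset _))).
rewrite varpi_totE /=.
under eq_bigr => w _ do rewrite PhiE FB_coefE.
rewrite exchange_big; apply: eq_bigr => b _ /=.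
rewrite -mulr_sumr; congr (_ * _).
have [n [a ->]] : exists n (a : wr B n), b = Wr a.
  by case: b => n a; exists n, a.
(* Coefficients of block products are known at standardizations of words, so the star is realized by
   a word v. *)
have [v stdv] := stdB_surj infA (wstar star (Wr a)).
rewrite -stdv block_prod_stdB -word_match_letters //.
have szv : size v == n by apply/eqP; exact: stdB_size stdv.
have [szs|szs] := eqVneq (size (letters_word L)) n.
  have szs' := introT eqP szs.
  apply: (sum_permutations_stdB starI K (s := Tuple szs') (v := Tuple szv)).
    exact: letters_word_sorted.
  exact: stdv.
rewrite /word_match (eqP szv) (negbTE szs) /= big1_seq // => w /andP[_].
rewrite mem_permutations => /perm_size szw.
by case: eqP => // /stdB_size; rewrite szw => e; rewrite e eqxx in szs.
Qed.

(** Positive multiplicities ensure that the corresponding block product lies in [DB]. *)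
Lemma mset_letters (m : {mset X}%mset) :
  exists L : seq (X * nat),
    [/\ pairwise <%O (unzip1 L), all (fun q => 0 < q.2)%N L &
        seq_mset (letters_word L) = m].
Proof.
pose s := sort <=%O m.
exists [seq (x, count_mem x s) | x <- undup s]; split.
- rewrite /unzip1 -map_comp map_id -(sorted_pairwise lt_trans).
  rewrite lt_sorted_uniq_le undup_uniq.
  apply: (subseq_sorted le_trans (undup_subseq _)).
  exact: sort_le_sorted.
- by apply/allP => _ /mapP[x xs ->]; rewrite -has_count has_pred1 -mem_undup.
- rewrite -[RHS]seq_mset_id; apply/eq_seq_msetP.
  rewrite /letters_word -map_comp.
  by rewrite (perm_trans (perm_count_undup s)) // perm_sort.
Qed.

(** Increasing A-components make the letters increase whatever their colors. A block of size 0
    becomes a letter of multiplicity 0, absent from the word. *)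
Lemma letters_of_blocks (L : seq (B * nat)) :
  exists2 L' : seq (X * nat),
    pairwise <%O (unzip1 L') & star_blocks star L' = L.
Proof.
have [l szl sl] := increasing_seq infA (size L).
exists [seq ((p.1, star p.2.1), p.2.2) | p <- zip l L].
  rewrite (sorted_pairwise lt_trans) in sl.
  rewrite /unzip1 -map_comp pairwise_map.
  have : pairwise (relpre fst <%O) (zip l L).
    by rewrite -pairwise_map -/(unzip1 _) unzip1_zip ?szl.
  apply: sub_pairwise => p q /= pq; rewrite ltEprodlexi /=.
  by rewrite (ltW pq) leNgt pq.
rewrite /star_blocks -map_comp -[RHS](@unzip2_zip _ _ l) ?szl //.
by apply: eq_map => -[p [b n]] /=; rewrite starI.
Qed.

(** By [abelianize_Phi], one inclusion tests x against the block products spanning [DB]; the other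
    realizes each multiset by a block product in [DB]. *)
Lemma Phi_abelianize_ker :
  (Phi K A B @^-1` abelianize_ker K X = DB_orth K star)%classic.
Proof.
apply/seteqP; split=> [x xker y /(DB_span infA)[r ->]|x xorth].
  rewrite varpi_tot_sum big1 // => q _.
  have [L pL <-] := letters_of_blocks q.2.
  by rewrite -abelianize_Phi // [abelianize _]xker mulr0.
apply/funext => m; have [L [pL L0 <-]] := mset_letters m.
rewrite abelianize_Phi //; apply: xorth; apply: DB_block_prod.
by rewrite all_map.
Qed.

End Pairing.

Local Open Scope classical_set_scope.

Theorem theorem6p1 (K : comPzRingType) (dA dB : Order.disp_t)
    (A : orderType dA) (B : finOrderType dB) (star : B -> B) :
  infinite_set [set: A] -> involutive star ->
  [/\ linear (Phi K A B),
      Phi K A B (FB1 K B) = ncseries1 K (A *l B)%type,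
      forall x y : FB K B,
        Phi K A B (ext_prod x y) =
        ncseries_mul (Phi K A B x) (Phi K A B y)
    & injective (Phi K A B)] /\
  Phi K A B @^-1` abelianize_ker K (A *l B)%type = DB_orth K star.
Proof.
move=> infA starI; split; last exact: Phi_abelianize_ker.
split; [exact: Phi_linear|exact: Phi1|exact: Phi_ext_prod|exact: Phi_inj].
Qed.
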